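(* Let $\mathfrak{L}$ be a left Leibniz algebra over a field $\mathbb{F}$, and let $M$ and $N$ be $\mathfrak{L}$-bimodules. Then the following statements hold (equalities of quotients of $M\otimes N$): (a) If $M$ is symmetric, then $M\,\overline{\otimes}\,N=M\,\underline{\otimes}\,N=(M\otimes N)/(\mathfrak{L}M\otimes N_0)$. (b) If $M$ is anti-symmetric, then $M\,\overline{\otimes}\,N=M\,\underline{\otimes}\,N=(M\otimes N)/(\mathfrak{L}M\otimes N\mathfrak{L})$. (c) If $N$ is symmetric, then $M\,\overline{\otimes}\,N=M\,\underline{\otimes}\,N=(M\otimes N)/(M_0\otimes\mathfrak{L}N)$. (d) If $N$ is anti-symmetric, then $M\,\overline{\otimes}\,N=M\,\underline{\otimes}\,N=(M\otimes N)/(M\mathfrak{L}\otimes\mathfrak{L}N)$.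
   Context: A left Leibniz algebra is an $\mathbb{F}$-vector space $\mathfrak{L}$ with a bilinear multiplication satisfying $x(yz)=(xy)z+y(xz)$. An $\mathfrak{L}$-bimodule is an $\mathbb{F}$-vector space $M$ with bilinear left and right $\mathfrak{L}$-actions satisfying, for all $x,y\in\mathfrak{L}$, $m\in M$: (LLM) $(xy)\cdot m=x\cdot(y\cdot m)-y\cdot(x\cdot m)$; (LML) $(x\cdot m)\cdot y=x\cdot(m\cdot y)-m\cdot(xy)$; (MLL) $(m\cdot x)\cdot y=m\cdot(xy)-x\cdot(m\cdot y)$. It is symmetric if $m\cdot x=-x\cdot m$ for all $x,m$, and anti-symmetric if $m\cdot x=0$ for all $x,m$. For $\mathfrak{L}$-bimodules $M,N$, the space $M\otimes N$ (over $\mathbb{F}$) carries the actions $x\cdot(m\otimes n):=(x\cdot m)\otimes n+m\otimes(x\cdot n)$ and $(m\otimes n)\cdot x:=(m\cdot x)\otimes n+m\otimes(n\cdot x)$. Let $T(M,N)$ be the smallest subspace of $M\otimes N$ that is closed under these left and right actions and contains $$S(M,N):=\{(x\cdot m+m\cdot x)\otimes(n\cdot y)+(m\cdot y)\otimes(x\cdot n+n\cdot x)\mid x,y\in\mathfrak{L},\ m\in M,\ n\in N\}.$$ Put $M_0:=\langle x\cdot m+m\cdot x\mid x\in\mathfrak{L},m\in M\rangle_{\mathbb{F}}$, $M\mathfrak{L}:=\langle m\cdot x\mid m\in M,x\in\mathfrak{L}\rangle_{\mathbb{F}}$, $\mathfrak{L}M:=\langle x\cdot m\mid x\in\mathfrak{L},m\in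 M\rangle_{\mathbb{F}}$ (similarly for $N$), and $T_0(M,N):=M_0\otimes N\mathfrak{L}+M\mathfrak{L}\otimes N_0\subseteq M\otimes N$. Define $M\,\overline{\otimes}\,N:=(M\otimes N)/T(M,N)$ and $M\,\underline{\otimes}\,N:=(M\otimes N)/T_0(M,N)$, with the induced actions. *)

(* Defs.v *)
From HB Require Import structures.
From mathcomp Require Import all_boot all_algebra.
From mathcomp Require Import boolp classical_sets.
From mathcomp Require Import finmap monalg.

Set Implicit Arguments.
Unset Strict Implicit.
Unset Printing Implicit Defensive.

Import GRing.Theory Quotient.

Local Open Scope classical_set_scope.
Local Open Scope quotient_scope.
Local Open Scope ring_scope.

Section Subspaces.
Variables (F : fieldType) (V : lmodType F).

Definition lspan (A : set V) : {pred V} :=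
  fun v => `[< forall U : submodClosed V, (forall a, A a -> a \in U) -> v \in U >].

Lemma lspanP (A : set V) v :
  reflect (forall U : submodClosed V, (forall a, A a -> a \in U) -> v \in U)
          (v \in lspan A).
Proof. exact: asboolP. Qed.

Lemma mem_lspan (A : set V) v : A v -> v \in lspan A.
Proof. by move=> Av; apply/lspanP => U; apply. Qed.

Lemma lspan_submod_closed A : GRing.submod_closed (lspan A).
Proof.
split=> [|a u v /lspanP hu /lspanP hv]; apply/lspanP => U AU; first exact: rpred0.
by rewrite rpredD ?rpredZ ?hu ?hv.
Qed.

HB.instance Definition _ A :=
  GRing.isSubmodClosed.Build F V (lspan A) (lspan_submod_closed A).

Lemma lspan_ind (A : set V) (P : V -> Prop) :
    (forall a, A a -> P a) -> P 0 ->
    (forall a u v, P u -> P v -> P (a *: u + v)) ->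
  forall v, v \in lspan A -> P v.
Proof.
move=> PA P0 PD v /lspanP hv.
pose S : {pred V} := fun v => `[< P v >].
have S_closed : GRing.submod_closed S.
  split=> [|a u w /asboolP Pu /asboolP Pw]; apply/asboolP => //; exact: PD.
pose US : submodClosed V := HB.pack_for (submodClosed V) S
  (GRing.isSubmodClosed.Build F V S S_closed).
by have /asboolP := hv US (fun a Aa => introT (asboolP _) (PA a Aa)).
Qed.

(* U + W *)
Definition addsp (U W : {pred V}) : {pred V} :=
  fun v => `[< exists u w, [/\ u \in U, w \in W & v = u + w] >].

Lemma addspP (U W : {pred V}) v :
  reflect (exists u w, [/\ u \in U, w \in W & v = u + w]) (v \in addsp U W).
Proof. exact: asboolP. Qed.

Lemma addsp_submod_closed (U W : submodClosed V) : GRing.submod_closed (addsp U W).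
Proof.
split=> [|a _ _ /addspP[u1 [w1 [u1U w1W ->]]] /addspP[u2 [w2 [u2U w2W ->]]]].
  by apply/addspP; exists 0, 0; rewrite addr0 !rpred0.
apply/addspP; exists (a *: u1 + u2), (a *: w1 + w2).
by rewrite scalerDr addrACA !rpredD ?rpredZ.
Qed.

HB.instance Definition _ (U W : submodClosed V) :=
  GRing.isSubmodClosed.Build F V (addsp U W) (addsp_submod_closed U W).

(* V / U : the library provides the additive group {quot U}, on which the
   scalars act through representatives. *)
Fact submod_oppr (U : submodClosed V) : GRing.oppr_closed U.
Proof. exact: GRing.zmod_closedN (GRing.submod_closedB (submodClosedP U)). Qed.

Definition zmod_of_submod (U : submodClosed V) : zmodClosed V :=
  HB.pack_for (zmodClosed V) (GRing.SubmodClosed.sort U)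
    (GRing.isOppClosed.Build V U (@submod_oppr U)).

Definition quot_space (U : submodClosed V) := {quot (zmod_of_submod U)}.

Section QuotSpace.
Variable U : submodClosed V.
Local Notation Q := (quot_space U).

HB.instance Definition _ := GRing.Zmodule.on Q.
HB.instance Definition _ : EqQuotient V (equiv (zmod_of_submod U)) Q := EqQuotient.on Q.

Definition quot_pi (v : V) : Q := \pi_Q v.

Lemma quot_piK : cancel repr quot_pi.
Proof. exact: reprK. Qed.

Lemma quot_piP u v : quot_pi u = quot_pi v <-> u - v \in U.
Proof.
by split=> [/eqP|h]; [rewrite -idealrBE | apply/eqP; rewrite -idealrBE].
Qed.

Lemma quot_pi_zmod : zmod_morphism quot_pi.
Proof. by move=> u v; exact: (raddfB (\pi_Q)). Qed.

HB.instance Definition _ := GRing.isZmodMorphism.Build V Q quot_pi quot_pi_zmod.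

Definition quot_scale a (q : Q) : Q := quot_pi (a *: repr q).

Lemma quot_scaleE a v : quot_scale a (quot_pi v) = quot_pi (a *: v).
Proof.
by apply/quot_piP; rewrite -scalerBr rpredZ //; apply/quot_piP; rewrite quot_piK.
Qed.

Fact quot_scaleA a b q : quot_scale a (quot_scale b q) = quot_scale (a * b) q.
Proof. by rewrite -[q]quot_piK !quot_scaleE scalerA. Qed.

Fact quot_scale1 : left_id 1 quot_scale.
Proof. by move=> q; rewrite -[q]quot_piK quot_scaleE scale1r. Qed.

Fact quot_scaleDr : right_distributive quot_scale +%R.
Proof.
move=> a q r; rewrite -[q]quot_piK -[r]quot_piK.
by rewrite -raddfD !quot_scaleE -raddfD scalerDr.
Qed.

Fact quot_scaleDl q : {morph quot_scale^~ q : a b / a + b}.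
Proof. by move=> a b; rewrite -[q]quot_piK !quot_scaleE -raddfD scalerDl. Qed.

HB.instance Definition _ := GRing.Zmodule_isLmodule.Build F Q
  quot_scaleA quot_scale1 quot_scaleDr quot_scaleDl.

Lemma quot_pi_scalable : scalable quot_pi.
Proof. by move=> a v; rewrite -quot_scaleE. Qed.

HB.instance Definition _ := GRing.isScalable.Build F V Q _ quot_pi quot_pi_scalable.

End QuotSpace.
End Subspaces.

(* M (x) N : the vector space with basis M * N, modulo bilinearity. *)
Section Tensor.
Variables (F : fieldType) (M N : lmodType F).
Local Notation free := {malg F[(M * N)%type]}.

Definition bilin_rel : set free :=
  [set z | (exists a m m' n,
             z = << (a *: m + m', n) >> - a *: << (m, n) >> - << (m', n) >>)
        \/ (exists a m n n',
             z = << (m, a *: n + n') >> - a *: << (m, n) >> - << (m, n') >>)].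

Definition tensor := quot_space (lspan bilin_rel).
HB.instance Definition _ := GRing.Lmodule.on tensor.

End Tensor.

(* tens, tensor_lact and tensor_ract are locked so that unification does not
   compute with representatives. *)
HB.lock Definition tens (F : fieldType) (M N : lmodType F) (m : M) (n : N) :
  tensor M N := quot_pi (lspan (@bilin_rel F M N)) << (m, n) >>.

Section TensorTheory.
Variables (F : fieldType) (M N : lmodType F).
Local Notation free := {malg F[(M * N)%type]}.
Local Notation bilin_rel := (@bilin_rel F M N).
Local Notation tensor := (tensor M N).
Local Notation tens := (@tens F M N).

Lemma tens_bilinear : bilinear_for *:%R *:%R tens.
Proof.
split=> [n a m m'|m a n n']; rewrite tens.unlock -linearP; apply/quot_piP;
  rewrite opprD addrA; apply: mem_lspan; [left|right].
  by exists a, m, m', n.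
by exists a, m, n, n'.
Qed.

HB.instance Definition _ :=
  bilinear_isBilinear.Build F M N tensor *:%R *:%R tens tens_bilinear.

Section Lift.
Variables (P : lmodType F) (f : M -> N -> P).

Definition free_lift (g : free) : P := \sum_(k <- msupp g) g@_k *: f k.1 k.2.

Lemma free_liftEw (g : free) (d : {fset M * N}) : (msupp g `<=` d)%fset ->
  free_lift g = \sum_(k <- d) g@_k *: f k.1 k.2.
Proof.
move=> gd; rewrite /free_lift; apply: big_fset_incl => // k _ kg.
by rewrite mcoeff_outdom // scale0r.
Qed.

Lemma free_lift_linear : linear free_lift.
Proof.
move=> a g h; pose d := (msupp g `|` msupp h)%fset.
have gd : (msupp g `<=` d)%fset by exact: fsubsetUl.
have hd : (msupp h `<=` d)%fset by exact: fsubsetUr.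
have ghd : (msupp (a *: g + h)%R `<=` d)%fset.
  apply: (fsubset_trans (msuppD_le _ _)).
  by rewrite fsubUset hd (fsubset_trans (msuppZ_le _ _) gd).
rewrite (free_liftEw gd) (free_liftEw hd) (free_liftEw ghd) scaler_sumr.
rewrite -big_split /=; apply: eq_bigr => k _.
by rewrite mcoeffD mcoeffZ scalerDl scalerA.
Qed.

HB.instance Definition _ :=
  GRing.isLinear.Build F free P _ free_lift free_lift_linear.

Lemma free_liftU m n : free_lift << (m, n) >> = f m n.
Proof.
by rewrite (free_liftEw msuppU_le) big_seq_fset1 mcoeffUU scale1r.
Qed.

Definition free_ker : {pred free} := fun g => free_lift g == 0.

Lemma free_ker_submod : GRing.submod_closed free_ker.
Proof.
split=> [|a g h]; rewrite !unfold_in /free_ker ?linear0 //.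
by move=> /eqP g0 /eqP h0; rewrite free_lift_linear /= g0 h0 scaler0 addr0.
Qed.

HB.instance Definition _ :=
  GRing.isSubmodClosed.Build F free free_ker free_ker_submod.

Definition tensor_lift (t : tensor) : P := free_lift (repr t).

Hypothesis f_bilin : bilinear_for *:%R *:%R f.

Lemma tensor_lift_pi g : tensor_lift (quot_pi (lspan bilin_rel) g) = free_lift g.
Proof.
apply/eqP; rewrite -subr_eq0 -linearB; rewrite -[_ == _]/(_ \in free_ker).
have : repr (quot_pi (lspan bilin_rel) g) - g \in lspan bilin_rel.
  by apply/quot_piP; rewrite quot_piK.
move/lspanP; apply=> z [[a [m [m' [n ->]]]]|[a [m [n [n' ->]]]]];
  rewrite unfold_in /free_ker !linearB linearZ /= !free_liftU.
  by rewrite (f_bilin.1 n) /= addrAC addrK subrr.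
by rewrite (f_bilin.2 m) /= addrAC addrK subrr.
Qed.

Lemma tensor_liftE m n : tensor_lift (tens m n) = f m n.
Proof. by rewrite tens.unlock tensor_lift_pi free_liftU. Qed.

Lemma tensor_lift_linear : linear tensor_lift.
Proof.
move=> a t u; rewrite -[t]quot_piK -[u]quot_piK -linearP !tensor_lift_pi.
exact: linearP.
Qed.

End Lift.

Lemma tensor_ind (P : tensor -> Prop) :
    (forall m n, P (tens m n)) -> P 0 ->
    (forall a t u, P t -> P u -> P (a *: t + u)) -> forall t, P t.
Proof.
move=> Pt P0 PD t; rewrite -[t]quot_piK [repr t]monalgE linear_sum.
apply: (big_ind P) => // [u v Pu Pv|[m n] _].
  by rewrite -[u]scale1r; apply: PD.
have -> : << (repr t)@_(m, n) *g (m, n) >>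
          = (repr t)@_(m, n) *: << (m, n) >> :> free.
  by apply/malgP => k; rewrite mcoeffZ !mcoeffU mulrnAr mulr1.
rewrite linearZ -[X in P X]addr0; apply: PD => //.
by have := Pt m n; rewrite tens.unlock.
Qed.

End TensorTheory.

Notation "m ⊗ n" := (tens m n) (at level 40, left associativity) : ring_scope.

HB.mixin Record isLeftLeibniz (F : fieldType) L of GRing.Lmodule F L := {
  lbr : L -> L -> L;
  lbr_bilinear : bilinear_for *:%R *:%R lbr;
  lbr_leibniz : forall x y z, lbr x (lbr y z) = lbr (lbr x y) z + lbr y (lbr x z)
}.

#[short(type="leftLeibnizType")]
HB.structure Definition LeftLeibniz (F : fieldType) :=
  { L of GRing.Lmodule F L & isLeftLeibniz F L }.

(* A space with two bilinear actions and no compatibility; M (x) N is in general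
   only of this kind. *)
HB.mixin Record hasBiaction (F : fieldType) (L : leftLeibnizType F) M
    of GRing.Lmodule F M := {
  lact : L -> M -> M;
  ract : M -> L -> M;
  lact_bilinear : bilinear_for *:%R *:%R lact;
  ract_bilinear : bilinear_for *:%R *:%R ract
}.

#[short(type="biactType")]
HB.structure Definition Biact (F : fieldType) (L : leftLeibnizType F) :=
  { M of GRing.Lmodule F M & hasBiaction F L M }.

Notation "x ⋅> m" := (lact x m) (at level 39, left associativity) : ring_scope.
Notation "m <⋅ x" := (ract m x) (at level 39, left associativity) : ring_scope.

HB.mixin Record isLeibnizBimodule (F : fieldType) (L : leftLeibnizType F) M
    of Biact F L M := {
  bimodLLM : forall (x y : L) (m : M),
    lact (lbr x y) m = lact x (lact y m) - lact y (lact x m);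
  bimodLML : forall (x y : L) (m : M),
    ract (lact x m) y = lact x (ract m y) - ract m (lbr x y);
  bimodMLL : forall (x y : L) (m : M),
    ract (ract m x) y = ract m (lbr x y) - lact x (ract m y)
}.

#[short(type="leibnizBimodType")]
HB.structure Definition LeibnizBimodule (F : fieldType) (L : leftLeibnizType F) :=
  { M of Biact F L M & isLeibnizBimodule F L M }.

Section BimoduleClasses.
Variables (F : fieldType) (L : leftLeibnizType F).

Definition symmetric_bimod (M : leibnizBimodType L) :=
  forall (x : L) (m : M), m <⋅ x = - (x ⋅> m).

Definition antisymmetric_bimod (M : leibnizBimodType L) :=
  forall (x : L) (m : M), m <⋅ x = 0.

End BimoduleClasses.

HB.lock Definition tensor_lact (F : fieldType) (L : leftLeibnizType F)
    (M N : biactType L) (x : L) (t : tensor M N) : tensor M N :=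
  tensor_lift (fun m n => (x ⋅> m) ⊗ n + m ⊗ (x ⋅> n)) t.

HB.lock Definition tensor_ract (F : fieldType) (L : leftLeibnizType F)
    (M N : biactType L) (t : tensor M N) (x : L) : tensor M N :=
  tensor_lift (fun m n => (m <⋅ x) ⊗ n + m ⊗ (n <⋅ x)) t.

Section TensorActions.
Variables (F : fieldType) (L : leftLeibnizType F) (M N : biactType L).
Local Notation tensor_lact := (@tensor_lact F L M N).
Local Notation tensor_ract := (@tensor_ract F L M N).

Let tl := (@tens_bilinear F M N).1.
Let tr := (@tens_bilinear F M N).2.

Fact tensor_lact_subproof x :
  bilinear_for *:%R *:%R (fun (m : M) (n : N) => (x ⋅> m) ⊗ n + m ⊗ (x ⋅> n)).
Proof.
split=> [n a m m'|m a n n'] /=; rewrite lact_bilinear.2.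
  by rewrite !(tl _ a) scalerDr addrACA.
by rewrite !(tr _ a) scalerDr addrACA.
Qed.

Fact tensor_ract_subproof x :
  bilinear_for *:%R *:%R (fun (m : M) (n : N) => (m <⋅ x) ⊗ n + m ⊗ (n <⋅ x)).
Proof.
split=> [n a m m'|m a n n'] /=; rewrite (ract_bilinear.1 x).
  by rewrite !(tl _ a) scalerDr addrACA.
by rewrite !(tr _ a) scalerDr addrACA.
Qed.

Lemma tensor_lactE x m n :
  tensor_lact x (m ⊗ n) = (x ⋅> m) ⊗ n + m ⊗ (x ⋅> n).
Proof. by rewrite tensor_lact.unlock; exact: (tensor_liftE (tensor_lact_subproof x)). Qed.

Lemma tensor_ractE x m n :
  tensor_ract (m ⊗ n) x = (m <⋅ x) ⊗ n + m ⊗ (n <⋅ x).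
Proof. by rewrite tensor_ract.unlock; exact: (tensor_liftE (tensor_ract_subproof x)). Qed.

Let lactP x : linear (tensor_lact x).
Proof. by rewrite tensor_lact.unlock; exact: tensor_lift_linear (tensor_lact_subproof x). Qed.

Let ractP x : linear (tensor_ract^~ x).
Proof. by rewrite tensor_ract.unlock; exact: tensor_lift_linear (tensor_ract_subproof x). Qed.

Let linear_map0 (U W : lmodType F) (f : U -> W) : linear f -> f 0 = 0.
Proof. by move/zmod_morphism_linear => fB; rewrite -{1}(subrr 0) fB subrr. Qed.

Fact tensor_lact_bilinear : bilinear_for *:%R *:%R tensor_lact.
Proof.
split=> [t a x y|x]; last exact: lactP.
elim/tensor_ind: t => [m n||b t u IHt IHu] /=.
- by rewrite !tensor_lactE !(lact_bilinear.1 _ a) tl tr scalerDr addrACA.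
- by rewrite !(linear_map0 (lactP _)) scaler0 addr0.
- rewrite (lactP (a *: x + y) b) (lactP x b) (lactP y b) /= IHt IHu.
  by rewrite !scalerDr !scalerA (mulrC b) addrACA.
Qed.

Fact tensor_ract_bilinear : bilinear_for *:%R *:%R tensor_ract.
Proof.
split=> [x|t a x y]; first exact: ractP.
elim/tensor_ind: t => [m n||b t u IHt IHu] /=.
- by rewrite !tensor_ractE !(ract_bilinear.2 _ a) tl tr scalerDr addrACA.
- by rewrite !(linear_map0 (ractP _)) scaler0 addr0.
- rewrite (ractP (a *: x + y) b) (ractP x b) (ractP y b) /= IHt IHu.
  by rewrite !scalerDr !scalerA (mulrC b) addrACA.
Qed.

HB.instance Definition _ := hasBiaction.Build F L (tensor M N)
  tensor_lact_bilinear tensor_ract_bilinear.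

End TensorActions.

Section Biactions.
Variables (F : fieldType) (L : leftLeibnizType F).

Section Quotients.
Variable V : biactType L.

Definition stable (U : {pred V}) :=
  forall (x : L) (u : V), u \in U -> (x ⋅> u \in U) /\ (u <⋅ x \in U).

Lemma ractD (u v : V) (x : L) : (u + v) <⋅ x = u <⋅ x + v <⋅ x.
Proof. by have := (ract_bilinear.1 x : linear _) 1 u v; rewrite !scale1r. Qed.

Lemma lactD (u v : V) (x : L) : x ⋅> (u + v) = x ⋅> u + x ⋅> v.
Proof. by have := (lact_bilinear.2 x : linear _) 1 u v; rewrite !scale1r. Qed.

Lemma lspan_stable (A : set V) :
  (forall (x : L) u, A u -> (x ⋅> u \in lspan A) /\ (u <⋅ x \in lspan A)) ->
  stable (lspan A).
Proof.
move=> h x u; move: u; apply: lspan_ind => [u /h //||a u v [u1 u2] [v1 v2]].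
  have l0 : x ⋅> (0 : V) = 0.
    by have := zmod_morphism_linear (lact_bilinear.2 x) (0 : V) 0; rewrite /= !subrr.
  have r0 : (0 : V) <⋅ x = 0.
    by have := zmod_morphism_linear (ract_bilinear.1 x) (0 : V) 0; rewrite /= !subrr.
  by rewrite l0 r0 rpred0.
by rewrite lact_bilinear.2 (ract_bilinear.1 x) !rpredD ?rpredZ.
Qed.

(* The smallest subspace closed under both actions and containing A. *)
Definition stable_span (A : set V) : {pred V} :=
  fun v => `[< forall U : submodClosed V,
                 stable U -> (forall a, A a -> a \in U) -> v \in U >].

Lemma stable_spanP (A : set V) v :
  reflect (forall U : submodClosed V,
             stable U -> (forall a, A a -> a \in U) -> v \in U)
          (v \in stable_span A).
Proof. exact: asboolP. Qed.

Lemma stable_span_submod_closed A : GRing.submod_closed (stable_span A).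
Proof.
split=> [|a u v /stable_spanP hu /stable_spanP hv]; apply/stable_spanP => U Ust AU.
  exact: rpred0.
by rewrite rpredD ?rpredZ ?hu ?hv.
Qed.

HB.instance Definition _ A :=
  GRing.isSubmodClosed.Build F V (stable_span A) (stable_span_submod_closed A).

Lemma stable_span_stable A : stable (stable_span A).
Proof.
move=> x u /stable_spanP hu.
by split; apply/stable_spanP => U Ust AU; case: (Ust x u (hu U Ust AU)).
Qed.

Lemma mem_stable_span (A : set V) v : A v -> v \in stable_span A.
Proof. by move=> Av; apply/stable_spanP => U _; apply. Qed.

(* A quotient of V comes with its projection: two quotients V/U and V/W are
   equal exactly when U = W, see quotientP. *)
Record quotient_of := Quotient {
  quo_space : lmodType F;
  quo_pi : V -> quo_space;
  quo_lact : L -> quo_space -> quo_space;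
  quo_ract : quo_space -> L -> quo_space
}.

(* The actions are those induced by V when U is stable, see quotient_lactE and
   quotient_ractE. *)
Definition quotient (U : submodClosed V) : quotient_of :=
  @Quotient (quot_space U) (quot_pi U)
    (fun x q => quot_pi U (x ⋅> repr q)) (fun q x => quot_pi U (repr q <⋅ x)).

Lemma quotient_lactE (U : submodClosed V) x v : stable U ->
  quo_lact x (quo_pi (quotient U) v) = quo_pi (quotient U) (x ⋅> v).
Proof.
move=> Ust; apply/quot_piP.
rewrite -(zmod_morphism_linear (lact_bilinear.2 x)).
by apply: (Ust _ _ _).1; apply/quot_piP; rewrite quot_piK.
Qed.

Lemma quotient_ractE (U : submodClosed V) x v : stable U ->
  quo_ract (quo_pi (quotient U) v) x = quo_pi (quotient U) (v <⋅ x).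
Proof.
move=> Ust; apply/quot_piP.
rewrite -(zmod_morphism_linear (ract_bilinear.1 x)).
by apply: (Ust _ _ _).2; apply/quot_piP; rewrite quot_piK.
Qed.

Lemma quotientP (U W : submodClosed V) : quotient U = quotient W <-> U =i W.
Proof.
split=> [eqUW v|eqUW].
  have kerE (X : submodClosed V) :
      v \in X <-> quo_pi (quotient X) v = quo_pi (quotient X) 0.
    by rewrite -{1}[v]subr0; apply: iff_sym; apply: quot_piP.
  by apply/idP/idP => /kerE h; apply/kerE; [rewrite -eqUW | rewrite eqUW].
suff -> : U = W by [].
case: U W eqUW => [U [[aU] [sU]]] [W [[aW] [sW]]] eqUW.
have eUW : U = W by apply: funext => v; exact: eqUW.
case: W / eUW aW sW eqUW => aW sW _.
by rewrite (Prop_irrelevance aU aW) (Prop_irrelevance sU sW).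
Qed.

End Quotients.

Section Truncated.

(* M_0, M L and L M *)
Definition sub0 (M : leibnizBimodType L) : submodClosed M :=
  lspan [set v | exists (x : L) (m : M), v = x ⋅> m + m <⋅ x].

Definition sub_ract (M : leibnizBimodType L) : submodClosed M :=
  lspan [set v | exists (m : M) (x : L), v = m <⋅ x].

Definition sub_lact (M : leibnizBimodType L) : submodClosed M :=
  lspan [set v | exists (x : L) (m : M), v = x ⋅> m].

Variables M N : leibnizBimodType L.

(* The image of U (x) W in M (x) N. *)
Definition tensor_sub (U : submodClosed M) (W : submodClosed N) :
    submodClosed (tensor M N) :=
  lspan [set t | exists m n, [/\ m \in U, n \in W & t = m ⊗ n]].

(* T(M,N) *)
Definition trunc_over : submodClosed (tensor M N) :=
  stable_span
    [set t | exists (x y : L) (m : M) (n : N),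
       t = (x ⋅> m + m <⋅ x) ⊗ (n <⋅ y) + (m <⋅ y) ⊗ (x ⋅> n + n <⋅ x)].

(* T_0(M,N) *)
Definition trunc_under : submodClosed (tensor M N) :=
  addsp (tensor_sub (sub0 M) (sub_ract N)) (tensor_sub (sub_ract M) (sub0 N)).

Definition tensor_over : quotient_of (tensor M N) := quotient trunc_over.
Definition tensor_under : quotient_of (tensor M N) := quotient trunc_under.

Lemma tensor_sub_stable (U : submodClosed M) (W : submodClosed N) :
  stable U -> stable W -> stable (tensor_sub U W).
Proof.
move=> Ust Wst; apply: lspan_stable => x _ [m [n [mU nW ->]]].
have [xm mx] := Ust x m mU; have [xn nx] := Wst x n nW.
split; [rewrite [_ ⋅> _]tensor_lactE|rewrite [_ <⋅ _]tensor_ractE].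
  by apply: rpredD; apply: mem_lspan; [exists (x ⋅> m), n | exists m, (x ⋅> n)].
by apply: rpredD; apply: mem_lspan; [exists (m <⋅ x), n | exists m, (n <⋅ x)].
Qed.

Lemma sub0_stable (P : leibnizBimodType L) : stable (sub0 P).
Proof.
apply: lspan_stable => x _ [y [m ->]]; split.
  rewrite lactD.
  have -> : x ⋅> (y ⋅> m) + x ⋅> (m <⋅ y) =
     ((lbr x y) ⋅> m + m <⋅ (lbr x y)) + (y ⋅> (x ⋅> m) + (x ⋅> m) <⋅ y).
    by rewrite bimodLML bimodLLM addrACA subrK; congr (_ + _); rewrite addrC subrK.
  apply: rpredD; apply: mem_lspan; first by exists (lbr x y), m.
  by exists y, (x ⋅> m).
by rewrite ractD bimodLML bimodMLL addrA subrK subrr rpred0.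
Qed.

Lemma sub_ract_stable (P : leibnizBimodType L) : stable (sub_ract P).
Proof.
apply: lspan_stable => x _ [m [y ->]]; split; last first.
  by apply: mem_lspan; exists (m <⋅ y), x.
have -> : x ⋅> (m <⋅ y) = (x ⋅> m) <⋅ y + m <⋅ (lbr x y).
  by rewrite bimodLML subrK.
apply: rpredD; apply: mem_lspan; first by exists (x ⋅> m), y.
by exists m, (lbr x y).
Qed.

Lemma trunc_under_stable : stable trunc_under.
Proof.
move=> x _ /addspP[u [w [uU wW ->]]].
have [a b] := tensor_sub_stable (@sub0_stable M) (@sub_ract_stable N) x uU.
have [c d] := tensor_sub_stable (@sub_ract_stable M) (@sub0_stable N) x wW.
rewrite lactD ractD; split; apply/addspP.
  by exists (x ⋅> u), (x ⋅> w).
by exists (u <⋅ x), (w <⋅ x).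
Qed.

End Truncated.
End Biactions.

(* Main.v *)
(** Each hypothesis makes one of the four subspaces [M_0], [M L], [N_0], [N L]
    vanish, hence one of the two summands of [T_0(M,N)], and the corresponding
    terms of the elements of [S(M,N)].  The remaining terms are exactly the
    tensors of generators of the surviving summand, so [T(M,N)] contains it; the
    reverse inclusion holds because [T_0(M,N)] is stable. *)
Require Import Defs.
From mathcomp Require Import all_boot all_algebra.
From mathcomp Require Import boolp classical_sets.
Import GRing.Theory.
Local Open Scope ring_scope.

Section LinearSpan.
Set Implicit Arguments.
Unset Strict Implicit.
Variables (F : fieldType) (V : lmodType F).

Lemma lspan_sub (A : set V) (U : submodClosed V) :
  (forall a, A a -> a \in U) -> {subset lspan A <= U}.
Proof. by move=> AU v /lspanP; apply. Qed.

Lemma lspan_eq0 (A : set V) :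
  (forall a, A a -> a = 0) -> forall v, v \in lspan A -> v = 0.
Proof.
by move=> A0; apply: lspan_ind => // a u v -> ->; rewrite scaler0 addr0.
Qed.

Lemma addsp0l (U W : submodClosed V) :
  (forall u, u \in U -> u = 0) -> addsp U W =i W.
Proof.
move=> U0 v; apply/addspP/idP => [[u [w [/U0 -> wW ->]]]|vW]; first by rewrite add0r.
by exists 0, v; rewrite add0r rpred0.
Qed.

Lemma addsp0r (U W : submodClosed V) :
  (forall w, w \in W -> w = 0) -> addsp U W =i U.
Proof.
move=> W0 v; apply/addspP/idP => [[u [w [uU /W0 -> ->]]]|vU]; first by rewrite addr0.
by exists v, 0; rewrite addr0 rpred0.
Qed.

End LinearSpan.

Section TruncatedTensor.
Set Implicit Arguments.
Unset Strict Implicit.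
Variables (F : fieldType) (L : leftLeibnizType F) (M N : leibnizBimodType L).

(** With one factor fixed, the vectors of the other factor whose tensor lands in [U] form a
    subspace, so span induction on the left factor and then on the right leaves only the
    generators. *)
Lemma tensor_sub_lspan (A : set M) (B : set N) (U : submodClosed (tensor M N)) :
  (forall a b, A a -> B b -> a ⊗ b \in U) ->
  {subset tensor_sub (lspan A) (lspan B) <= U}.
Proof.
move=> ABU; apply: lspan_sub => _ [m [n [mA nB ->]]].
move: m mA; apply: lspan_ind => [a Aa||c u v uU vU].
- move: n nB; apply: lspan_ind => [b Bb||c u v uU vU].
  + exact: ABU.
  + by rewrite linear0r rpred0.
  + by rewrite linearPr rpredD ?rpredZ.
- by rewrite linear0l rpred0.
- by rewrite linearPl rpredD ?rpredZ.
Qed.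

Lemma tensor_sub0l (U : submodClosed M) (W : submodClosed N) :
  (forall m, m \in U -> m = 0) -> forall t, t \in tensor_sub U W -> t = 0.
Proof.
by move=> U0; apply: lspan_eq0 => _ [m [n [/U0 -> _ ->]]]; exact: linear0l.
Qed.

Lemma tensor_sub0r (U : submodClosed M) (W : submodClosed N) :
  (forall n, n \in W -> n = 0) -> forall t, t \in tensor_sub U W -> t = 0.
Proof.
by move=> W0; apply: lspan_eq0 => _ [m [n [_ /W0 -> ->]]]; exact: linear0r.
Qed.

Lemma mem_sub0 (P : leibnizBimodType L) (x : L) (m : P) :
  x ⋅> m + m <⋅ x \in sub0 P.
Proof. by apply: mem_lspan; exists x, m. Qed.

Lemma mem_sub_ract (P : leibnizBimodType L) (x : L) (m : P) :
  m <⋅ x \in sub_ract P.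
Proof. by apply: mem_lspan; exists m, x. Qed.

Lemma mem_tensor_sub (U : submodClosed M) (W : submodClosed N) m n :
  m \in U -> n \in W -> m ⊗ n \in tensor_sub U W.
Proof. by move=> mU nW; apply: mem_lspan; exists m, n. Qed.

Lemma trunc_over_sub : {subset trunc_over M N <= trunc_under M N}.
Proof.
move=> t /stable_spanP; apply; first exact: trunc_under_stable.
move=> _ [x [y [m [n ->]]]]; apply/addspP.
(* The two terms of a generator fall one into each summand of [trunc_under]. *)
exists ((x ⋅> m + m <⋅ x) ⊗ (n <⋅ y)), ((m <⋅ y) ⊗ (x ⋅> n + n <⋅ x)).
by rewrite !mem_tensor_sub ?mem_sub0 ?mem_sub_ract.
Qed.

Lemma mem_trunc_over (x y : L) (m : M) (n : N) :
  (x ⋅> m + m <⋅ x) ⊗ (n <⋅ y) + (m <⋅ y) ⊗ (x ⋅> n + n <⋅ x) \in trunc_over M N.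
Proof. by apply: mem_stable_span; exists x, y, m, n. Qed.

(** Common core of two cases: $M$ symmetric, where $M_0 = 0$, and $N$ anti-symmetric, where
    $N\mathfrak{L} = 0$. *)
Lemma tensor_over_under_left :
  (forall t, t \in tensor_sub (sub0 M) (sub_ract N) -> t = 0) ->
  tensor_over M N = tensor_under M N /\
  tensor_under M N = quotient (tensor_sub (sub_ract M) (sub0 N)).
Proof.
move=> t0; have underE := addsp0l (tensor_sub (sub_ract M) (sub0 N)) t0.
(* Equal quotients amount to equal subspaces; the second equality is then [underE]. *)
split; apply/quotientP => //.
move=> t; apply/idP/idP; first exact: trunc_over_sub.
rewrite underE; apply: tensor_sub_lspan => _ _ [m [y ->]] [x [n ->]].
have := mem_trunc_over x y m n.
(* The first term lies in the vanishing summand, so the generator reduces to the required pure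
   tensor. *)
by rewrite [X in X + _]t0 ?add0r // mem_tensor_sub ?mem_sub0 ?mem_sub_ract.
Qed.

(** Mirror core, for $M$ anti-symmetric ($M\mathfrak{L} = 0$) and $N$ symmetric ($N_0 = 0$). *)
Lemma tensor_over_under_right :
  (forall t, t \in tensor_sub (sub_ract M) (sub0 N) -> t = 0) ->
  tensor_over M N = tensor_under M N /\
  tensor_under M N = quotient (tensor_sub (sub0 M) (sub_ract N)).
Proof.
move=> t0; have underE := addsp0r (tensor_sub (sub0 M) (sub_ract N)) t0.
split; apply/quotientP => //.
move=> t; apply/idP/idP; first exact: trunc_over_sub.
rewrite underE; apply: tensor_sub_lspan => _ _ [x [m ->]] [n [y ->]].
have := mem_trunc_over x y m n.
by rewrite [X in _ + X]t0 ?addr0 // mem_tensor_sub ?mem_sub0 ?mem_sub_ract.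
Qed.

End TruncatedTensor.

Section BimoduleClasses.
Set Implicit Arguments.
Unset Strict Implicit.
Variables (F : fieldType) (L : leftLeibnizType F) (P : leibnizBimodType L).

Lemma symmetric_sub0 :
  symmetric_bimod P -> forall v, v \in sub0 P -> v = 0.
Proof. by move=> symP; apply: lspan_eq0 => _ [x [m ->]]; rewrite symP subrr. Qed.

Lemma antisymmetric_sub_ract :
  antisymmetric_bimod P -> forall v, v \in sub_ract P -> v = 0.
Proof. by move=> antiP; apply: lspan_eq0 => _ [m [x ->]]; exact: antiP. Qed.

(** Since $x\cdot m = (-m)\cdot x$, both spans have the same generating set. Equality of the
    structures, rather than of their elements, allows rewriting under [quotient]. *)
Lemma symmetric_sub_lact : symmetric_bimod P -> sub_lact P = sub_ract P.
Proof.
have lactN x (m : P) : x ⋅> (- m) = - (x ⋅> m).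
  by rewrite -!scaleN1r (scalable_linear (lact_bilinear.2 x)).
move=> symP; rewrite /sub_lact /sub_ract; congr (lspan _ : submodClosed P).
apply/seteqP; split=> v [].
  by move=> x [m ->]; exists (- m), x; rewrite symP lactN opprK.
by move=> m [x ->]; exists x, (- m); rewrite symP lactN.
Qed.

(** With zero right action, the generator $x\cdot m + m\cdot x$ is just $x\cdot m$. *)
Lemma antisymmetric_sub_lact : antisymmetric_bimod P -> sub_lact P = sub0 P.
Proof.
move=> antiP; rewrite /sub_lact /sub0; congr (lspan _ : submodClosed P).
by apply/seteqP; split=> v [x [m ->]]; exists x, m; rewrite antiP addr0.
Qed.

End BimoduleClasses.

Theorem theorem4p6 (F : fieldType) (L : leftLeibnizType F)
    (M N : leibnizBimodType L) :
  [/\ symmetric_bimod M ->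
        tensor_over M N = tensor_under M N /\
        tensor_under M N = quotient (tensor_sub (sub_lact M) (sub0 N)),
      antisymmetric_bimod M ->
        tensor_over M N = tensor_under M N /\
        tensor_under M N = quotient (tensor_sub (sub_lact M) (sub_ract N)),
      symmetric_bimod N ->
        tensor_over M N = tensor_under M N /\
        tensor_under M N = quotient (tensor_sub (sub0 M) (sub_lact N))
    & antisymmetric_bimod N ->
        tensor_over M N = tensor_under M N /\
        tensor_under M N = quotient (tensor_sub (sub_ract M) (sub_lact N))].
Proof.
split=> classH.
(* In each case $\mathfrak{L}M$ or $\mathfrak{L}N$ is first rewritten as the subspace occurring in
   the surviving summand of $T_0(M,N)$; here $\mathfrak{L}M = M\mathfrak{L}$. *)
- rewrite symmetric_sub_lact //; apply: tensor_over_under_left.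
  exact/tensor_sub0l/symmetric_sub0.
- rewrite antisymmetric_sub_lact //; apply: tensor_over_under_right.
  exact/tensor_sub0l/antisymmetric_sub_ract.
- rewrite symmetric_sub_lact //; apply: tensor_over_under_right.
  exact/tensor_sub0r/symmetric_sub0.
- rewrite antisymmetric_sub_lact //; apply: tensor_over_under_left.
  exact/tensor_sub0r/antisymmetric_sub_ract.
Qed.
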